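(* Let $a\in\mathbb R$, $\lambda>0$ with $|a|<\lambda$, and fix $\Delta x,\Delta t>0$ with $\lambda\sigma\le1$, $\sigma=\Delta t/\Delta x$, and an integer $N\ge1$. Fix a real sequence $(u_j^0)_{j\in\mathbb Z}$, independent of $\varepsilon$, with $\sum_{j\in\mathbb Z}(u_{j+1}^0-u_j^0)^2<\infty$. For each $\varepsilon>0$ let $(\mathbf U_j^n)$, $\mathbf U_j^n=(u_j^n,v_j^n)^\top$, be generated by the Lie splitting scheme with parameter $\varepsilon$ from the well-prepared data $(u_j^0,v_j^0)$, $v_j^0=au_j^0$, and let $(\bar u_j^n)$ be the solution of the limiting scheme with $\bar u_j^0=u_j^0$ (both schemes are given in the context). Put $$\rho=\frac{\varepsilon}{\varepsilon+\Delta t},\qquad S_N(\varepsilon)=\varepsilon(1-\rho^N).$$ Then there is a constant $C>0$, which may depend on the fixed discretization parameters, on $N$, on $a,\lambda$ and on the initial data but not on $\varepsilon$, such that $$\Phi_{\mathrm{rel}}^N\le C\bigl(\rho^2+S_N(\varepsilon)^2\bigr).$$ Consequently, for fixed $\Delta x,\Delta t,N$, $\Phi_{\mathrm{rel}}^N=O(\varepsilon^2)$ in the regime $\varepsilon\ll\Delta t$ (i.e. as $\varepsilon\to0$).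
   Context: Notation: $A=\begin{pmatrix}0&1\\\lambda^2&0\end{pmatrix}$, $H=\begin{pmatrix}\lambda^2&-a\\-a&1\end{pmatrix}$, $\mathbf F(\mathbf U)=A\mathbf U$, $\mathbf R(\mathbf U)=(0,\,au-v)^\top$ for $\mathbf U=(u,v)^\top$. Lie splitting scheme: for $j\in\mathbb Z$, $n\in\mathbb N$, $$\mathbf U_j^{n+\frac12}=\mathbf U_j^n-\sigma(\widehat{\mathbf F}_{j+\frac12}^n-\widehat{\mathbf F}_{j-\frac12}^n),\quad \widehat{\mathbf F}_{j+\frac12}^n=\tfrac12\bigl(\mathbf F(\mathbf U_j^n)+\mathbf F(\mathbf U_{j+1}^n)\bigr)-\tfrac\lambda2(\mathbf U_{j+1}^n-\mathbf U_j^n),$$ $$\mathbf U_j^{n+1}=\mathbf U_j^{n+\frac12}+\frac{\Delta t}{\varepsilon}\mathbf R(\mathbf U_j^{n+1}).$$ Limiting scheme: $$\bar u_j^{n+1}=\bar u_j^n-\sigma(\widehat f_{j+\frac12}^n-\widehat f_{j-\frac12}^n),\quad \widehat f_{j+\frac12}^n=\tfrac a2(\bar u_j^n+\bar u_{j+1}^n)-\tfrac\lambda2(\bar u_{j+1}^n-\bar u_j^n).$$ Global discrete relative entropy, with $\bar{\mathbf U}_j^n=(\bar u_j^n,a\bar u_j^n)^\top$: $$\Phi_{\mathrm{rel}}^n=\frac{\Delta x}{2}\sum_{j\in\mathbb Z}(\mathbf U_j^n-\bar{\mathbf U}_j^n)^\top H(\mathbf U_j^n-\bar{\mathbf U}_j^n).$$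 *)

(* Defs.v *)
From HB Require Import structures.
From mathcomp Require Import all_boot all_order all_algebra.
From mathcomp Require Import all_classical all_reals all_analysis.

Set Implicit Arguments.
Unset Strict Implicit.
Unset Printing Implicit Defensive.

Import Order.TTheory GRing.Theory Num.Theory.
Import numFieldNormedType.Exports.

Local Open Scope classical_set_scope.
Local Open Scope ring_scope.

Definition vec2 (R : realType) (x y : R) : 'cV[R]_2 :=
  \col_i (if i == 0 then x else y).

Definition mat2 (R : realType) (p q r s : R) : 'M[R]_2 :=
  \matrix_(i, j) if i == 0 then (if j == 0 then p else q)
                 else (if j == 0 then r else s).

Definition matA (R : realType) (lam : R) : 'M[R]_2 :=
  mat2 0 1 (lam ^+ 2) 0.

Definition matH (R : realType) (a lam : R) : 'M[R]_2 :=
  mat2 (lam ^+ 2) (- a) (- a) 1.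

Definition fluxF (R : realType) (lam : R) (U : 'cV[R]_2) : 'cV[R]_2 :=
  matA lam *m U.

Definition sourceR (R : realType) (a : R) (U : 'cV[R]_2) : 'cV[R]_2 :=
  vec2 0 (a * U 0 0 - U 1 0).

(* Numerical flux at the interface j + 1/2; the one at j - 1/2 is the value
   at the index j - 1. *)
Definition numfluxF (R : realType) (lam : R) (U : int -> 'cV[R]_2) (j : int) :
    'cV[R]_2 :=
  2^-1 *: (fluxF lam (U j) + fluxF lam (U (j + 1)))
  - (lam / 2) *: (U (j + 1) - U j).

Definition lie_half_step (R : realType) (lam sigma : R)
    (U : int -> 'cV[R]_2) (j : int) : 'cV[R]_2 :=
  U j - sigma *: (numfluxF lam U j - numfluxF lam U (j - 1)).

(* The relaxation step is implicit in U n.+1 j, so the scheme is a relation;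
   it determines U n.+1 from U n as soon as 0 < dt and 0 < eps. *)
Definition lie_splitting (R : realType) (a lam dx dt eps : R)
    (U : nat -> int -> 'cV[R]_2) : Prop :=
  forall (n : nat) (j : int),
    U n.+1 j = lie_half_step lam (dt / dx) (U n) j
               + (dt / eps) *: sourceR a (U n.+1 j).

Definition numfluxf (R : realType) (a lam : R) (u : int -> R) (j : int) : R :=
  a / 2 * (u j + u (j + 1)) - lam / 2 * (u (j + 1) - u j).

Definition limiting_scheme (R : realType) (a lam dx dt : R)
    (u : nat -> int -> R) : Prop :=
  forall (n : nat) (j : int),
    u n.+1 j = u n j - dt / dx * (numfluxf a lam (u n) j
                                  - numfluxf a lam (u n) (j - 1)).

Definition entropy_density (R : realType) (a lam : R) (V : 'cV[R]_2) : R :=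
  (V^T *m matH a lam *m V) 0 0.

(* For `|a| < lam the matrix H is positive definite, so this is a sum of
   nonnegative terms, with value +oo when the series diverges. *)
Definition relative_entropy (R : realType) (a lam dx : R)
    (U : int -> 'cV[R]_2) (u : int -> R) : \bar R :=
  ((dx / 2)%:E *
   \esum_(j in [set: int])
     (entropy_density a lam (U j - vec2 (u j) (a * u j)))%:E)%E.

Definition relax_ratio (R : realType) (dt eps : R) : R := eps / (eps + dt).

Definition relax_sum (R : realType) (dt : R) (N : nat) (eps : R) : R :=
  eps * (1 - relax_ratio dt eps ^+ N).

(* Main.v *)
Require Import Defs.
From HB Require Import structures.
From mathcomp Require Import all_boot all_order all_algebra.
From mathcomp Require Import all_classical all_reals all_analysis.
From mathcomp Require Import ring lra.

Set Implicit Arguments.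
Unset Strict Implicit.
Unset Printing Implicit Defensive.

Import Order.TTheory GRing.Theory Num.Theory.
Import numFieldNormedType.Exports.

Local Open Scope classical_set_scope.
Local Open Scope ring_scope.

(** Write [w = v - a u] for the distance to equilibrium, [e = u - ubar] for the
    error on the conserved variable and [d j = u (j + 1) - u j].  The entropy
    density of the error is the diagonal form [(lam^2 - a^2) e^2 + w^2]
    ([entropy_density_error]), so it suffices to bound [e] and [w] in l^2.

    Let [viscous b] be one step of the limiting scheme with velocity [b].  With
    [sigma = dt / dx], one step of the splitting scheme reads
      [u' = viscous a u - (sigma / 2) (w (j + 1) - w (j - 1))],
      [w' = rho (viscous (- a) w
                 - (sigma / 2) (lam^2 - a^2) (u (j + 1) - u (j - 1)))]
    ([lie_step_u], [lie_step_w]).  The data enter the equation for [w'] only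
    through [d], which is square summable, and the implicit relaxation gains a
    factor [rho <= 1].  By linearity and shift invariance, an induction on [n]
    shows that the sum of [d^2] stays bounded uniformly in [eps], while the sum of
    [w^2] is [O(rho^2)]; since [e] starts from 0 and is driven by [w] only, the
    sum of [e^2] is [O(rho^2)] as well ([lie_estimates]).  Hence the relative entropy at a fixed
    time index is [O(rho^2)], which is stronger than the bound asserted, and
    [rho <= eps / dt] gives [O(eps^2)]. *)

(** * Uniform square summability of families of sequences *)

Lemma ge0_esumZl_le (R : realType) (T : choiceType) (I : set T)
    (a : T -> \bar R) (c : R) :
  0 <= c -> (forall i, 0 <= a i)%E ->
  (\esum_(i in I) (c%:E * a i) <= c%:E * \esum_(i in I) a i)%E.
Proof.
move=> c0 a0; apply: ge_ereal_sup => _ [X [finX XI]] <-.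
rewrite -ge0_mule_fsumr//; apply: lee_wpmul2l; first by rewrite lee_fin.
by apply: ereal_sup_ubound; exists X.
Qed.

(** [sq_bounded r f]: the sums over [int] of the squares of the sequences
    [f eps] are at most [C * r eps], with one constant [C] for all [eps > 0]. *)
Definition sq_bounded (R : realType) (r : R -> R) (f : R -> int -> R) : Prop :=
  exists2 C : R, 0 <= C & forall eps, 0 < eps ->
    (\esum_(j in [set: int]) ((f eps j) ^+ 2)%:E <= (C * r eps)%:E)%E.

Section SqBounded.
Variable R : realType.
Implicit Types (r s : R -> R) (f g : R -> int -> R).

Lemma eq_sq_bounded r f g :
  (forall eps j, 0 < eps -> f eps j = g eps j) ->
  sq_bounded r f -> sq_bounded r g.
Proof.
move=> fg [C C0 fC]; exists C => // eps eps0.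
apply: le_trans (fC _ eps0); apply: le_esum => j _.
by rewrite fg.
Qed.

Lemma sq_bounded_weaken r s f :
  (forall eps, 0 < eps -> r eps <= s eps) ->
  sq_bounded r f -> sq_bounded s f.
Proof.
move=> rs [C C0 fC]; exists C => // eps eps0.
apply: le_trans (fC _ eps0) _; rewrite lee_fin.
by apply: ler_wpM2l => //; apply: rs.
Qed.

Lemma sq_bounded0 r :
  (forall eps, 0 < eps -> 0 <= r eps) -> sq_bounded r (fun=> fun=> 0).
Proof.
move=> r0; exists 0 => // eps eps0.
by rewrite esum1 ?mul0r// => j _; rewrite expr0n.
Qed.

Lemma sq_boundedM r (c : R -> R) f :
  sq_bounded r f ->
  sq_bounded (fun eps => c eps ^+ 2 * r eps) (fun eps j => c eps * f eps j).
Proof.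
move=> [C C0 fC]; exists C => // eps eps0.
under eq_esum do rewrite exprMn EFinM.
apply: (le_trans (ge0_esumZl_le _ (sqr_ge0 _) _)).
  by move=> j; rewrite lee_fin sqr_ge0.
rewrite mulrCA (EFinM _ (C * r eps)); apply: lee_wpmul2l; last exact: fC.
by rewrite lee_fin sqr_ge0.
Qed.

Lemma sq_boundedZ r (c : R) f :
  sq_bounded r f -> sq_bounded r (fun eps j => c * f eps j).
Proof.
move=> /(sq_boundedM (fun=> c)) [C C0 fC].
exists (C * c ^+ 2) => [|eps eps0]; first by rewrite mulr_ge0 ?sqr_ge0.
by rewrite -mulrA; apply: fC.
Qed.

Lemma sq_boundedD r f g :
  sq_bounded r f -> sq_bounded r g ->
  sq_bounded r (fun eps j => f eps j + g eps j).
Proof.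
move=> [C C0 fC] [D D0 gD]; exists (2 * C + 2 * D) => [|eps eps0]; first by lra.
have sq0 (h : int -> R) j : (0 <= ((h j) ^+ 2)%:E)%E by rewrite lee_fin sqr_ge0.
apply: (@le_trans _ _ (\esum_(j in [set: int])
    (2%:E * ((f eps j) ^+ 2)%:E + 2%:E * ((g eps j) ^+ 2)%:E))%E).
  apply: le_esum => j _; rewrite -!EFinM -EFinD lee_fin.
  have := sqr_ge0 (f eps j - g eps j); rewrite !expr2; nra.
rewrite esumD; [|by move=> j _; rewrite mule_ge0..].
rewrite mulrDl (EFinD (2 * C * r eps)); apply: leeD.
- apply: (le_trans (ge0_esumZl_le _ _ (sq0 _))) => //.
  by rewrite -mulrA (EFinM 2); apply: lee_wpmul2l => //; apply: fC.
- apply: (le_trans (ge0_esumZl_le _ _ (sq0 _))) => //.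
  by rewrite -mulrA (EFinM 2); apply: lee_wpmul2l => //; apply: gD.
Qed.

Lemma sq_bounded_shift r (k : int) f :
  sq_bounded r f -> sq_bounded r (fun eps j => f eps (j + k)).
Proof.
move=> [C C0 fC]; exists C => // eps eps0; have := fC _ eps0.
rewrite (reindex_esum [set: int] [set: int] (fun j => j + k))//.
split=> //; first by move=> i j _ _ /addIr.
by move=> j _; exists (j - k) => //; rewrite subrK.
Qed.

End SqBounded.

(** * One step of the splitting scheme *)

(** One step of the limiting scheme with velocity [b]. *)
Definition viscous (R : realType) (b lam sigma : R) (f : int -> R) (j : int) :
    R :=
  f j - sigma * (b / 2 * (f (j + 1) - f (j - 1))
                 - lam / 2 * (f (j + 1) - 2 * f j + f (j - 1))).

Lemma sq_bounded_viscous (R : realType) (r : R -> R) (b lam sigma : R)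
    (f : R -> int -> R) :
  sq_bounded r f -> sq_bounded r (fun eps => viscous b lam sigma (f eps)).
Proof.
move=> fr.
apply: (@eq_sq_bounded _ _ (fun eps j =>
    (1 - sigma * lam) * f eps j + sigma * (lam - b) / 2 * f eps (j + 1)
    + sigma * (lam + b) / 2 * f eps (j - 1))).
  by move=> eps j _; rewrite /viscous; field.
apply: sq_boundedD; last exact: sq_boundedZ (sq_bounded_shift (-1) fr).
apply: sq_boundedD; last exact: sq_boundedZ (sq_bounded_shift 1 fr).
exact: sq_boundedZ.
Qed.

Lemma limiting_step (R : realType) (a lam dx dt : R) (u : nat -> int -> R) n j :
  limiting_scheme a lam dx dt u -> u n.+1 j = viscous a lam (dt / dx) (u n) j.
Proof.
move=> ->; rewrite /numfluxf /viscous subrK.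
by move: (dt / dx) => sigma; field.
Qed.

Lemma vec2E (R : realType) (x y : R) :
  (vec2 x y 0 0 = x) * (vec2 x y 1 0 = y).
Proof. by rewrite !mxE. Qed.

Lemma fluxFE (R : realType) (lam : R) (V : 'cV[R]_2) :
  (fluxF lam V 0 0 = V 1 0) * (fluxF lam V 1 0 = lam ^+ 2 * V 0 0).
Proof.
split; rewrite /fluxF !mxE !big_ord_recl big_ord0 !mxE /=.
- by rewrite (_ : lift _ _ = 1); [ring | apply/val_inj].
- by ring.
Qed.

Section OneStep.
Variables (R : realType) (a lam dx dt eps : R) (U : nat -> int -> 'cV[R]_2).
Hypotheses (dt_gt0 : 0 < dt) (eps_gt0 : 0 < eps).
Hypothesis schemeU : lie_splitting a lam dx dt eps U.

Let sigma := dt / dx.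
Let u n j := U n j 0 0.
Let w n j := U n j 1 0 - a * U n j 0 0.

Lemma lie_step_u n j :
  u n.+1 j = viscous a lam sigma (u n) j
             - sigma / 2 * (w n (j + 1) - w n (j - 1)).
Proof.
rewrite /u schemeU /lie_half_step /numfluxF /sourceR subrK.
rewrite !(fluxFE, vec2E, mxE) /=.
by rewrite mulr0 /viscous /w -/sigma; clearbody sigma; field.
Qed.

Lemma lie_step_w n j :
  w n.+1 j = relax_ratio dt eps
    * (viscous (- a) lam sigma (w n) j
       - sigma / 2 * (lam ^+ 2 - a ^+ 2) * (u n (j + 1) - u n (j - 1))).
Proof.
have := lie_step_u n j; rewrite /viscous /u /w => uE.
have vE : U n.+1 j 1 0 = lie_half_step lam sigma (U n) j 1 0
    + dt / eps * (a * U n.+1 j 0 0 - U n.+1 j 1 0).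
  by rewrite {1}schemeU !mxE.
move: vE; rewrite /lie_half_step /numfluxF subrK !(fluxFE, vec2E, mxE) => vE.
(* [vE] is implicit in the new [v]: multiply by [eps] and solve for
   [(eps + dt) * w n.+1 j] *)
have eps0 : eps != 0 by rewrite gt_eqF.
have s0 : eps + dt != 0 by rewrite gt_eqF ?addr_gt0.
apply: (mulfI s0); rewrite /relax_ratio.
move: vE => /(congr1 (fun z => eps * z)).
rewrite mulrDr !mulrA [eps * dt]mulrC mulfK// => vE.
have -> : (eps + dt) * (U n.+1 j 1 0 - a * U n.+1 j 0 0)
  = eps * U n.+1 j 1 0 - dt * (a * U n.+1 j 0 0 - U n.+1 j 1 0)
    - eps * a * U n.+1 j 0 0 by ring.
rewrite vE addrK uE; clearbody sigma; field.
exact: s0.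
Qed.

End OneStep.

(** * Estimates uniform in the relaxation parameter *)

Section RelaxRatio.
Variables (R : realType) (dt eps : R).
Hypotheses (dt_gt0 : 0 < dt) (eps_gt0 : 0 < eps).

Lemma relax_ratio_ge0 : 0 <= relax_ratio dt eps.
Proof. by rewrite divr_ge0 ?addr_ge0 ?ltW. Qed.

Lemma relax_ratio_sqr_le1 : relax_ratio dt eps ^+ 2 <= 1.
Proof.
rewrite expr_le1 ?relax_ratio_ge0//.
by rewrite ler_pdivrMr ?addr_gt0// mul1r lerDl ltW.
Qed.

Lemma relax_ratio_sqr_le : relax_ratio dt eps ^+ 2 <= dt ^- 2 * eps ^+ 2.
Proof.
rewrite [_ * _]mulrC -expr_div_n lerXn2r ?nnegrE ?relax_ratio_ge0//.
  by rewrite divr_ge0 ?ltW.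
rewrite /relax_ratio (ler_wpM2l (ltW eps_gt0))// lef_pV2 ?posrE ?addr_gt0//.
by rewrite lerDr ltW.
Qed.

End RelaxRatio.

(** The three bounds are proved together: the new [w] is fed by the old [w] and
    the differences of [u], these by themselves and the old [w], and the error
    [u - ubar] by itself and the old [w].  In each case the step formula is
    rewritten as a linear combination of shifts of the bounded families. *)
Lemma lie_estimates (R : realType) (a lam dx dt : R)
    (u0 : int -> R) (U : R -> nat -> int -> 'cV[R]_2) (ubar : nat -> int -> R)
    (dt_gt0 : 0 < dt)
    (summable_du0 :
       (\esum_(j in [set: int]) ((u0 (j + 1) - u0 j) ^+ 2)%:E < +oo)%E)
    (schemeU : forall eps : R, 0 < eps -> lie_splitting a lam dx dt eps (U eps))
    (initU : forall eps : R, 0 < eps ->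
       forall j : int, U eps 0%N j = vec2 (u0 j) (a * u0 j))
    (scheme_ubar : limiting_scheme a lam dx dt ubar)
    (init_ubar : forall j : int, ubar 0%N j = u0 j) (n : nat) :
  let rho2 eps := relax_ratio dt eps ^+ 2 in
  [/\ sq_bounded (fun=> 1) (fun eps j => U eps n (j + 1) 0 0 - U eps n j 0 0),
      sq_bounded rho2 (fun eps j => U eps n j 1 0 - a * U eps n j 0 0) &
      sq_bounded rho2 (fun eps j => U eps n j 0 0 - ubar n j)].
Proof.
move=> rho2.
have rho2_ge0 eps : 0 < eps -> 0 <= rho2 eps by move=> _; apply: sqr_ge0.
have rho2_le1 eps : 0 < eps -> rho2 eps <= 1.
  by move=> eps0; apply: relax_ratio_sqr_le1.
elim: n => [|n [du w e]].
  split.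
  - have du0_ge0 :
        (0 <= \esum_(j in [set: int]) ((u0 (j + 1) - u0 j) ^+ 2)%:E)%E.
      by apply: esum_ge0 => j _; rewrite lee_fin sqr_ge0.
    exists (fine (\esum_(j in [set: int]) ((u0 (j + 1) - u0 j) ^+ 2)%:E)).
      exact: fine_ge0.
    move=> eps eps0.
    rewrite mulr1 fineK ?ge0_fin_numE//; apply: le_esum => j _.
    by rewrite !initU// !vec2E.
  - apply: eq_sq_bounded (sq_bounded0 rho2_ge0) => eps j eps0.
    by rewrite initU// !vec2E subrr.
  - apply: eq_sq_bounded (sq_bounded0 rho2_ge0) => eps j eps0.
    by rewrite initU// vec2E init_ubar subrr.
have w1 := sq_bounded_weaken rho2_le1 w.
split.
- apply: (@eq_sq_bounded _ _ (fun eps j =>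
    viscous a lam (dt / dx) (fun i => U eps n (i + 1) 0 0 - U eps n i 0 0) j
    + (- (dt / dx / 2)) * ((U eps n (j + 2) 1 0 - a * U eps n (j + 2) 0 0)
       + (-1) * (U eps n j 1 0 - a * U eps n j 0 0)
       + (-1) * (U eps n (j + 1) 1 0 - a * U eps n (j + 1) 0 0)
       + (U eps n (j - 1) 1 0 - a * U eps n (j - 1) 0 0)))).
    move=> eps j eps0; rewrite !(lie_step_u (schemeU _ eps0)) /viscous.
    by rewrite -[j + 1 + 1]addrA subrK addrK; ring.
  apply: sq_boundedD; first exact: sq_bounded_viscous.
  apply: sq_boundedZ.
  apply: sq_boundedD; last exact: (sq_bounded_shift (-1) w1).
  apply: sq_boundedD; last exact: sq_boundedZ (sq_bounded_shift 1 w1).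
  apply: sq_boundedD; last exact: sq_boundedZ w1.
  exact: (sq_bounded_shift 2 w1).
- apply: (@eq_sq_bounded _ _ (fun eps j => relax_ratio dt eps *
    (viscous (- a) lam (dt / dx) (fun i => U eps n i 1 0 - a * U eps n i 0 0) j
     + (- (dt / dx / 2 * (lam ^+ 2 - a ^+ 2)))
       * ((U eps n (j + 1) 0 0 - U eps n j 0 0)
          + (U eps n (j - 1 + 1) 0 0 - U eps n (j - 1) 0 0))))).
    move=> eps j eps0; rewrite (lie_step_w dt_gt0 eps0 (schemeU _ eps0)).
    by rewrite subrK; ring.
  apply: (@sq_bounded_weaken _ (fun eps => rho2 eps * 1)).
    by move=> eps _; rewrite mulr1.
  apply: sq_boundedM; apply: sq_boundedD; first exact: sq_bounded_viscous.
  apply: sq_boundedZ; apply: sq_boundedD => //.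
  exact: (sq_bounded_shift (-1) du).
- apply: (@eq_sq_bounded _ _ (fun eps j =>
    viscous a lam (dt / dx) (fun i => U eps n i 0 0 - ubar n i) j
    + (- (dt / dx / 2)) * ((U eps n (j + 1) 1 0 - a * U eps n (j + 1) 0 0)
       + (-1) * (U eps n (j - 1) 1 0 - a * U eps n (j - 1) 0 0)))).
    move=> eps j eps0; rewrite (lie_step_u (schemeU _ eps0)).
    by rewrite (limiting_step _ _ scheme_ubar) /viscous; ring.
  apply: sq_boundedD; first exact: sq_bounded_viscous.
  apply: sq_boundedZ; apply: sq_boundedD.
  + exact: (sq_bounded_shift 1 w).
  + exact: sq_boundedZ (sq_bounded_shift (-1) w).
Qed.

(** * Relative entropy *)

Lemma entropy_density_error (R : realType) (a lam x : R) (V : 'cV[R]_2) :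
  entropy_density a lam (V - vec2 x (a * x))
  = (lam ^+ 2 - a ^+ 2) * (V 0 0 - x) ^+ 2 + (V 1 0 - a * V 0 0) ^+ 2.
Proof.
rewrite /entropy_density !mxE !big_ord_recl big_ord0 !mxE.
rewrite !big_ord_recl !big_ord0 !mxE /=.
by rewrite (_ : lift _ _ = 1); [ring | apply/val_inj].
Qed.

(** A family [V] is compared with the equilibrium state [(x, a x)]; the two
    bounds together make the relative entropy finite. *)
Lemma relative_entropy_le (R : realType) (a lam dx : R) (r : R -> R)
    (V : R -> int -> 'cV[R]_2) (x : int -> R) :
  `|a| < lam -> 0 < dx -> (forall eps, 0 < eps -> 0 <= r eps) ->
  sq_bounded r (fun eps j => V eps j 1 0 - a * V eps j 0 0) ->
  sq_bounded r (fun eps j => V eps j 0 0 - x j) ->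
  exists2 C : R, 0 < C & forall eps, 0 < eps ->
    (0 <= relative_entropy a lam dx (V eps) x <= (C * r eps)%:E)%E.
Proof.
move=> ha dx0 r0 [C C0 wC] [D D0 eD].
have k0 : 0 <= lam ^+ 2 - a ^+ 2.
  rewrite subr_ge0 -[a ^+ 2]real_normK ?num_real//.
  have lam0 := le_lt_trans (normr_ge0 a) ha.
  by rewrite lerXn2r ?nnegrE//; apply: ltW.
have h0 : 0 <= dx / 2 by lra.
have e0 (W : R) : (0 <= (W ^+ 2)%:E)%E by rewrite lee_fin sqr_ge0.
set k := lam ^+ 2 - a ^+ 2 in k0.
(* the summand 1 only makes the constant positive *)
exists (dx / 2 * (k * D + C) + 1) => [|eps eps0].
  by rewrite ltr_wpDl ?ltr01// mulr_ge0// addr_ge0// mulr_ge0.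
rewrite /relative_entropy.
under eq_esum do rewrite entropy_density_error EFinD EFinM.
rewrite -/k esumD; [|by move=> j _; rewrite ?mule_ge0..].
apply/andP; split.
  by rewrite mule_ge0// adde_ge0// esum_ge0// => j _; rewrite mule_ge0.
apply: (@le_trans _ _
  ((dx / 2)%:E * (k%:E * (D * r eps)%:E + (C * r eps)%:E))%E).
  apply: lee_wpmul2l; first by rewrite lee_fin.
  apply: leeD; last exact: wC.
  apply: (le_trans (ge0_esumZl_le _ _ _)) => //.
  by apply: lee_wpmul2l => //; apply: eD.
rewrite -(EFinM k) -EFinD -(EFinM (dx / 2)) lee_fin [leRHS]mulrDl mul1r.
rewrite (_ : dx / 2 * (k * (D * r eps) + C * r eps)
           = dx / 2 * (k * D + C) * r eps); last by ring.
by rewrite lerDl r0.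
Qed.

Theorem mainTheorem4 (R : realType) (a lam dx dt : R) (N : nat)
    (u0 : int -> R) (U : R -> nat -> int -> 'cV[R]_2) (ubar : nat -> int -> R)
    (hlam : 0 < lam) (ha : `|a| < lam) (hdx : 0 < dx) (hdt : 0 < dt)
    (hCFL : lam * (dt / dx) <= 1) (hN : (1 <= N)%N)
    (hu0 : (\esum_(j in [set: int]) ((u0 (j + 1) - u0 j) ^+ 2)%:E < +oo)%E)
    (hU : forall eps : R, 0 < eps -> lie_splitting a lam dx dt eps (U eps))
    (hU0 : forall eps : R, 0 < eps ->
       forall j : int, U eps 0%N j = vec2 (u0 j) (a * u0 j))
    (hubar : limiting_scheme a lam dx dt ubar)
    (hubar0 : forall j : int, ubar 0%N j = u0 j) :
  (exists2 C : R, 0 < C &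
     forall eps : R, 0 < eps ->
       (relative_entropy a lam dx (U eps N) (ubar N)
        <= (C * (relax_ratio dt eps ^+ 2 + relax_sum dt N eps ^+ 2))%:E)%E)
  /\
  (fun eps : R => fine (relative_entropy a lam dx (U eps N) (ubar N)))
    =O_ (0^'+) (fun eps : R => eps ^+ 2).
Proof.
have [_ w e] := lie_estimates hdt hu0 hU hU0 hubar hubar0 N.
have rho2_ge0 eps : 0 < eps -> 0 <= relax_ratio dt eps ^+ 2.
  by move=> _; apply: sqr_ge0.
have [C C0 entC] := relative_entropy_le ha hdx rho2_ge0 w e.
split.
  exists C => // eps /entC /andP[_ /le_trans]; apply; rewrite lee_fin.
  by apply: ler_wpM2l; [exact: ltW | rewrite lerDl sqr_ge0].
apply/eqO_exP; exists (C * dt ^- 2).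
  by rewrite mulr_gt0// invr_gt0 exprn_gt0.
near=> eps.
have eps0 : 0 < eps by near: eps; exact: nbhs_right_gt.
have /andP[ent0 entle] := entC _ eps0.
rewrite ger0_norm ?fine_ge0// ger0_norm ?sqr_ge0// -lee_fin fineK; last first.
  by rewrite ge0_fin_numE// (le_lt_trans entle)// ltry.
apply: (le_trans entle); rewrite lee_fin -mulrA.
by apply: ler_wpM2l; [exact: ltW | exact: relax_ratio_sqr_le].
Unshelve. all: by end_near. Qed.
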